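(* Let $X$ be a uniformly convex and uniformly smooth Banach space and let $A:X\to 2^X$ be an m-accretive operator such that there exists a weak modulus for the convergence condition $\Omega:\mathbb{N}\times\mathbb{N}^{\mathbb{N}}\to\mathbb{N}^{\mathbb{N}}$ for $A$. Let $\mathcal{S}=\{S(t)\mid t\geq 0\}$ be the semigroup generated by $A$ via the exponential formula. Let $A^{-1}0\neq\emptyset$ with $p\in A^{-1}0$ and assume that $P$, the nearest point projection onto $A^{-1}0$, is uniformly continuous on bounded subsets of $X$ with a modulus $\omega:\mathbb{N}^2\to\mathbb{N}$, i.e. $$\forall r,k\in\mathbb{N}\ \forall x,y\in \overline{B}_r(p) \left( \|x-y\|\leq \frac{1}{\omega(r,k)+1} \to \|Px-Py\|\leq \frac{1}{k+1} \right),$$ and (without loss of generality) that $\omega(r,k)\geq k$ for all $r,k\in\mathbb{N}$. Let $u$ be an almost-orbit of $\mathcal{S}$ with a rate of metastability $\Phi:\mathbb{N}\times\mathbb{N}^{\mathbb{N}}\to\mathbb{N}$ on the almost-orbit condition, i.e. $$\forall k\in\mathbb{N}\ \forall f:\mathbb{N}\to\mathbb{N}\ \exists n\leq \Phi(k,f)\ \forall t\in [0,f(n)] \left( \|S(t)u(n)-u(t+n)\|\leq \frac{1}{k+1} \right).$$ Let $B\in\mathbb{N}\setminus\{0\}$ be such that $\|u(t)-p\|\leq B$ for all $t\geq 0$ and, for each $s\geq 0$, let $f_s:\mathbb{N}\to\mathbb{N}$ be nondecreasing and such that $$\forall n\in\mathbb{N}\ \exists x_{s,n},y_{s,n}\in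 X\left(y_{s,n}\in Ax_{s,n}\land \|x_{s,n}\|,\|y_{s,n}\|\leq f_s(n)\land \|x_{s,n}-u(s)\|\leq\frac{1}{n+1}\right).$$ Then we have $$\forall k\in\mathbb{N}\ \forall f:\mathbb{N}\to \mathbb{N}\ \exists n\leq \Gamma(k, f)\ \forall t,t'\in [n, n+f(n)] \left( \|u(t)-u(t')\|\leq \frac{1}{k+1} \right),$$ where $$\Gamma(k, f):=\max\{\Gamma'(8k+7,j_{k,f}),\Phi(8k+7, h_{N,f})\mid N\leq \Gamma'(8k+7, j_{k,f})\}$$ with $$h_{N,f}(n):=f(\max\{N,n \}) + \max\{N,n\} - n,$$ $$j_{k,f}(n):=\max\{n,\Phi(8k+7,h_{n,f})\}-n,$$ $$g_{k,f}(m):=\Omega_{m}(3k+2) + f(m+\Omega_{m}(3k+2)),$$ $$\Gamma'(k,f):= \Phi(\omega(B, 3k+2), g_{k,f})+\max\{\Omega_{m}(3k+2)\mid m\leq\Phi(\omega(B, 3k+2), g_{k,f})\},$$ where $\Omega_s(k)$ for $s\geq 0$ is defined by $$\Omega_s(k):=\chi(\Omega(K_{s,k},\mathrm{id})(3k+2)),\qquad \chi(k):=\left\lceil\frac{1}{2}(B+1)^2+1\right\rceil(k+1),$$ for any $K_{s,k}\in\mathbb{N}$ with $K_{s,k}\geq\max\{f_s(\omega(B+1, 3k+2)), B+1+\|p\|\}$.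
   Context: $\mathbb{N}=\{0,1,2,\dots\}$ and $\mathrm{id}:\mathbb{N}\to\mathbb{N}$ is the identity; $t,t',s$ range over reals, and intervals $[a,b]$ are real intervals. $\overline{B}_r(p)$ is the closed ball of radius $r$ around $p$. $X$ is a real Banach space. Since $X$ is uniformly smooth, its normalized duality map $J(x)=\{f\in X^*\mid f(x)=\|x\|^2,\ \|f\|=\|x\|\}$ is single-valued; it is identified with a map $J:X\to X^*$ and $\langle y,J(x)\rangle$ denotes $J(x)(y)$. A set-valued operator $A:X\to 2^X$ is identified with its graph $\{(x,y)\mid y\in Ax\}$; $\mathrm{dom}A=\{x\mid Ax\neq\emptyset\}$ and $A^{-1}0=\{x\mid 0\in Ax\}$. $A$ is accretive if $\langle y_1-y_2,J(x_1-x_2)\rangle\geq 0$ for all $(x_1,y_1),(x_2,y_2)\in A$, and m-accretive if in addition $\mathrm{ran}(\mathrm{Id}+\gamma A)=X$ for all $\gamma>0$. If $A$ is m-accretive with $A^{-1}0\neq\emptyset$, then $A^{-1}0$ is closed and convex and $P$ denotes the (single-valued) nearest point projection of $X$ onto $A^{-1}0$. The semigroup generated by $A$ via the exponential formula is given by $S(t)x=\lim_{n\to\infty}(\mathrm{Id}+\frac{t}{n}A)^{-n}x$ for $x\in\overline{\mathrm{dom}A}$, $t\geq 0$ (the limit exists by the Crandall–Liggett theorem, and the $S(t)$ form a semigroup of nonexpansive maps on $\overline{\mathrm{dom}A}$, continuous in $t$). An almost-orbit of $\mathcal{S}$ is a continuous function $u:[0,\infty)\to\overline{\mathrm{dom}A}$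 such that $\lim_{s\to\infty}\sup\{\|u(t+s)-S(t)u(s)\|\mid t\geq 0\}=0$. For a sequence $(a_n)$ of non-negative reals, $\varphi:\mathbb{N}\to\mathbb{N}$ is a rate of convergence (towards zero) if $\forall k\,\forall n\geq\varphi(k)\,(a_n\leq\frac{1}{k+1})$, and a rate of approximate zeros if $\forall k\,\exists n\leq\varphi(k)\,(a_n\leq\frac1{k+1})$. A weak modulus for the convergence condition for $A$ is a functional $\Omega:\mathbb{N}\times\mathbb{N}^{\mathbb{N}}\to\mathbb{N}^{\mathbb{N}}$ such that for any sequences $(x_n),(y_n)\subseteq X$, any $K\in\mathbb{N}$ and any $\varphi:\mathbb{N}\to\mathbb{N}$: if $y_n\in Ax_n$ and $\|x_n\|,\|y_n\|\leq K$ for all $n$, and $\varphi$ is a rate of convergence for $|\langle y_n,J(x_n-Px_n)\rangle|$, then $\Omega(K,\varphi)$ is a rate of approximate zeros for $\|x_n-Px_n\|$. *)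

(* Defs.v *)
From HB Require Import structures.
From mathcomp Require Import all_boot all_order all_algebra.
From mathcomp Require Import all_classical all_reals all_analysis.

Set Implicit Arguments.
Unset Strict Implicit.
Unset Printing Implicit Defensive.

Import Order.TTheory GRing.Theory Num.Theory.
Import numFieldNormedType.Exports.

Local Open Scope classical_set_scope.
Local Open Scope ring_scope.

Definition uniformly_convex (R : realType) (X : normedModType R) : Prop :=
  forall eps : R, 0 < eps <= 2 -> exists2 delta : R, 0 < delta &
    forall x y : X, `|x| <= 1 -> `|y| <= 1 -> eps <= `|x - y| ->
      `|2^-1 *: (x + y)| <= 1 - delta.

Definition uniformly_smooth (R : realType) (X : normedModType R) : Prop :=
  forall eps : R, 0 < eps -> exists2 delta : R, 0 < delta &
    forall x y : X, `|x| = 1 -> `|y| <= delta ->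
      `|x + y| + `|x - y| <= 2 + eps * `|y|.

Definition dual_space (R : realType) (X : normedModType R) : set (X -> R^o) :=
  [set f | linear f /\ continuous f].

Definition dual_norm (R : realType) (X : normedModType R) (f : X -> R^o) : R :=
  sup [set `|f x| | x in [set x : X | `|x| <= 1]].

Definition duality_set (R : realType) (X : normedModType R) (x : X) :
    set (X -> R^o) :=
  [set f | [/\ dual_space f, f x = `|x| ^+ 2 & dual_norm f = `|x| ]].

(* In a uniformly smooth space [duality_set x] is a singleton, and
   [duality_map x] is its element; [duality_map x y] is the pairing
   <y, J(x)>.  The default value is irrelevant there. *)
Definition duality_map (R : realType) (X : normedModType R) (x : X) :
    X -> R^o :=
  xget (fun=> 0) (duality_set x).

Definition op_dom (R : realType) (X : normedModType R) (A : X -> set X) :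
    set X :=
  [set x | A x !=set0].

Definition op_ran (R : realType) (X : normedModType R) (A : X -> set X) :
    set X :=
  \bigcup_x A x.

Definition zeros (R : realType) (X : normedModType R) (A : X -> set X) :
    set X :=
  [set x | A x 0].

(* Id + gamma A *)
Definition id_plus (R : realType) (X : normedModType R) (gamma : R)
    (A : X -> set X) : X -> set X :=
  fun x => [set x + gamma *: y | y in A x].

Definition accretive (R : realType) (X : normedModType R) (A : X -> set X) :
    Prop :=
  forall x1 y1 x2 y2 : X, A x1 y1 -> A x2 y2 ->
    0 <= duality_map (x1 - x2) (y1 - y2).

Definition m_accretive (R : realType) (X : normedModType R)
    (A : X -> set X) : Prop :=
  accretive A /\
  forall gamma : R, 0 < gamma -> op_ran (id_plus gamma A) = setT.

(* (Id + gamma A)^-1, single-valued and total for A m-accretive and gamma > 0.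
   The default value x makes it the identity for gamma = 0, also at points of
   the closure of the domain that are not in the domain, so that S(0) = Id. *)
Definition resolvent (R : realType) (X : normedModType R) (A : X -> set X)
    (gamma : R) (x : X) : X :=
  xget x [set z | id_plus gamma A z x].

(* The term n = 0 (where t / 0 = 0) does not affect the limit. *)
Definition semigroup (R : realType) (X : normedModType R) (A : X -> set X)
    (t : R) (x : X) : X :=
  lim (iter n (resolvent A (t / n%:R)) x @[n --> \oo]).

(* Nearest point projection onto C, for C nonempty closed convex in a
   uniformly convex Banach space. *)
Definition nearest_point (R : realType) (X : normedModType R) (C : set X)
    (x : X) : X :=
  xget x [set z | C z /\ forall w, C w -> `|x - z| <= `|x - w| ].

Definition zero_proj (R : realType) (X : normedModType R) (A : X -> set X) :
    X -> X :=
  nearest_point (zeros A).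

(* A function on [0, +oo[ is a total function on R of which only the
   restriction to [0, +oo[ matters.  The supremum is taken in the extended
   reals, as it may be infinite for small s. *)
Definition almost_orbit (R : realType) (X : normedModType R) (A : X -> set X)
    (u : R -> X) : Prop :=
  [/\ {within [set t : R | 0 <= t], continuous u},
      forall t : R, 0 <= t -> closure (op_dom A) (u t) &
      ereal_sup [set (`|u (t + s) - semigroup A t (u s)|)%:E
                | t in [set t : R | 0 <= t]] @[s --> +oo] --> 0%E].

Definition rate_of_convergence (R : realType) (a : nat -> R)
    (phi : nat -> nat) : Prop :=
  forall k n : nat, (phi k <= n)%N -> a n <= k.+1%:R^-1.

Definition rate_of_approximate_zeros (R : realType) (a : nat -> R)
    (phi : nat -> nat) : Prop :=
  forall k : nat, exists2 n : nat, (n <= phi k)%N & a n <= k.+1%:R^-1.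

Definition weak_modulus (R : realType) (X : normedModType R)
    (A : X -> set X) (Omega : nat -> (nat -> nat) -> nat -> nat) : Prop :=
  forall (x y : nat -> X) (K : nat) (phi : nat -> nat),
    (forall n, A (x n) (y n)) ->
    (forall n, `|x n| <= K%:R /\ `|y n| <= K%:R) ->
    rate_of_convergence
      (fun n => `|duality_map (x n - zero_proj A (x n)) (y n)| : R) phi ->
    rate_of_approximate_zeros
      (fun n => `|x n - zero_proj A (x n)|) (Omega K phi).

(* Closed balls are spelled out, as [closed_ball p 0] is empty in the
   library. *)
Definition unif_cont_modulus (R : realType) (X : normedModType R)
    (P : X -> X) (p : X) (omega : nat -> nat -> nat) : Prop :=
  forall (r k : nat) (x y : X), `|x - p| <= r%:R -> `|y - p| <= r%:R ->
    `|x - y| <= (omega r k).+1%:R^-1 -> `|P x - P y| <= k.+1%:R^-1.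

Definition metastability_rate (R : realType) (X : normedModType R)
    (A : X -> set X) (u : R -> X) (Phi : nat -> (nat -> nat) -> nat) : Prop :=
  forall (k : nat) (f : nat -> nat), exists2 n : nat, (n <= Phi k f)%N &
    forall t : R, 0 <= t <= (f n)%:R ->
      `|semigroup A t (u n%:R) - u (t + n%:R)| <= k.+1%:R^-1.

Definition chi (R : realType) (B k : nat) : nat :=
  (`|Num.ceil (2^-1 * (B%:R + 1) ^+ 2 + 1 : R)| * k.+1)%N.

(* Omega_s(k) *)
Definition Omega_at (R : realType) (B : nat)
    (Omega : nat -> (nat -> nat) -> nat -> nat) (K : R -> nat -> nat)
    (s : R) (k : nat) : nat :=
  chi R B (Omega (K s k) id (3 * k + 2)%N).

Definition g_fun (R : realType) (B : nat)
    (Omega : nat -> (nat -> nat) -> nat -> nat) (K : R -> nat -> nat)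
    (k : nat) (f : nat -> nat) (m : nat) : nat :=
  let O := Omega_at B Omega K m%:R (3 * k + 2)%N in (O + f (m + O))%N.

Definition Gamma' (R : realType) (B : nat)
    (Omega : nat -> (nat -> nat) -> nat -> nat) (K : R -> nat -> nat)
    (omega : nat -> nat -> nat) (Phi : nat -> (nat -> nat) -> nat)
    (k : nat) (f : nat -> nat) : nat :=
  let M := Phi (omega B (3 * k + 2)%N) (g_fun B Omega K k f) in
  (M + \max_(m < M.+1) Omega_at B Omega K (m%:R : R) (3 * k + 2))%N.

Definition h_fun (N : nat) (f : nat -> nat) (n : nat) : nat :=
  (f (maxn N n) + maxn N n - n)%N.

Definition j_fun (Phi : nat -> (nat -> nat) -> nat) (k : nat)
    (f : nat -> nat) (n : nat) : nat :=
  (maxn n (Phi (8 * k + 7) (h_fun n f)) - n)%N.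

Definition Gamma (R : realType) (B : nat)
    (Omega : nat -> (nat -> nat) -> nat -> nat) (K : R -> nat -> nat)
    (omega : nat -> nat -> nat) (Phi : nat -> (nat -> nat) -> nat)
    (k : nat) (f : nat -> nat) : nat :=
  let G := Gamma' B Omega K omega Phi (8 * k + 7)%N (j_fun Phi k f) in
  maxn G (\max_(N < G.+1) Phi (8 * k + 7)%N (h_fun N f)).

(* Main.v *)
(* The resolvents play the role of the trajectories: no differentiability of the
   semigroup is used.  Along the implicit Euler iterates x_i = J_l^i x, with
   y_i = (x_(i-1) - x_i) / l in A x_i, the energy |x_i - P x_i|^2 decreases by at
   least 2 l <y_i, J(x_i - P x_(i-1))> at each step.  Hence the pairing is small
   for some i with i l bounded, and uniform continuity of P and of J
   turns P x_(i-1) into P x_i as l tends to 0.  The weak modulus then yields an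
   iterate close to the zero set.  Kobayashi's estimate transfers this to the
   semigroup: some zero q is close to S(t) u(m) for all late t, since |S(t) a - q|
   is nonincreasing in t.  Metastability of the almost-orbit condition, used
   twice (the counterfunction j provides the window for the second use),
   carries the closeness over to u. *)

Require Import Defs.
From mathcomp Require Import all_boot all_order all_algebra.
From mathcomp Require Import all_classical all_reals all_analysis.
From mathcomp Require Import ring lra.
Import Order.TTheory GRing.Theory Num.Theory.
Import numFieldNormedType.Exports.
Local Open Scope classical_set_scope.
Local Open Scope ring_scope.

Set Implicit Arguments.
Unset Strict Implicit.
Unset Printing Implicit Defensive.

(** * Functionals in the duality set *)

Section Duality.
Context {R : realType} {X : normedModType R}.
Implicit Types (x y z v w : X) (f g : X -> R^o).

Lemma linear_cont_le f (C : R) : linear f -> (forall v, `|f v| <= C * `|v|) ->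
  continuous f.
Proof.
move=> fl fC v; apply/cvgrPdist_lt => e e0.
have C0 : 0 < `|C| + 1 by rewrite ltr_wpDl.
near=> w.
have fB : f (v - w) = f v - f w.
  by rewrite addrC -scaleN1r fl scaleN1r addrC.
rewrite -fB (le_lt_trans (fC _))// (@le_lt_trans _ _ ((`|C| + 1) * `|v - w|))//.
  by rewrite ler_wpM2r// (le_trans (ler_norm _))// lerDl.
rewrite -ltr_pdivlMl//.
near: w; apply: cvgr_dist_lt => //.
by rewrite mulr_gt0// invr_gt0.
Unshelve. all: by end_near. Qed.

(** The pointwise bound caps the supremum in [dual_norm], and for nonzero [x] the unit vector
    [|x|^-1 *: x] attains it. Continuity follows from the same bound. *)
Lemma duality_setP x f : linear f -> f x = `|x| ^+ 2 ->
  (forall v, `|f v| <= `|x| * `|v|) -> duality_set x f.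
Proof.
move=> fl fx fle; have fc := linear_cont_le fl fle.
split => //; rewrite /dual_norm.
have f0 : f 0 = 0.
  by have := fl (-1) 0 0; rewrite scaleN1r oppr0 addr0 scaleN1r addNr.
have fZ a v : f (a *: v) = a * f v by have := fl a v 0; rewrite !addr0 f0 addr0.
have ub : ubound [set `|f v| | v in [set v : X | `|v| <= 1]] `|x|.
  move=> _ [v /= v1 <-]; apply: (le_trans (fle v)).
  by rewrite ler_piMr.
apply/eqP; rewrite eq_le; apply/andP; split.
  apply: ge_sup => //; exists `|f 0|, 0 => //=.
  by rewrite normr0.
have [->|x0] := eqVneq x 0.
  by rewrite normr0; apply: ub_le_sup;
    [exists `|x| | exists 0 => /=; rewrite ?f0 ?normr0].
apply: ub_le_sup; first by exists `|x|.
exists (`|x|^-1 *: x) => /=.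
  by rewrite normrZ normfV normr_id mulVf// normr_eq0.
rewrite fZ fx expr2 mulKf ?normr_eq0//.
by rewrite normr_id.
Qed.

(** The [sup] in [dual_norm] is informative only for a bounded set, so continuity at 0 is used first
    to bound [f] on the unit ball. Rescaling [v] to norm 1 then gives the estimate. *)
Lemma duality_set_bound x f v : duality_set x f -> `|f v| <= `|x| * `|v|.
Proof.
move=> [[fl fc] fx fn].
have f0 : f 0 = 0.
  by have := fl (-1) 0 0; rewrite scaleN1r oppr0 addr0 scaleN1r addNr.
have fZ a w : f (a *: w) = a * f w by have := fl a w 0; rewrite !addr0 f0 addr0.
have [d d0 fd] : exists2 d : R, 0 < d & forall w, `|w| <= d -> `|f w| <= 1.
  have /cvgrPdist_lt/(_ 1 ltr01) := fc 0.
  rewrite f0 => /nbhs_norm0P[e /= e0 fe].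
  exists (e / 2); first by rewrite divr_gt0.
  move=> w we; have := fe w; rewrite /= sub0r normrN => h; apply/ltW/h.
  by rewrite (le_lt_trans we)// ltr_pdivrMr// mulr_natr mulr2n ltrDl.
have [->|v0] := eqVneq v 0; first by rewrite f0 !normr0 mulr0.
have vp : 0 < `|v| by rewrite normr_gt0.
rewrite -ler_pdivrMr// -[leLHS]ger0_norm ?divr_ge0//.
rewrite -fn; apply: ub_le_sup.
  exists d^-1 => _ [w /= w1 <-].
  have := fd (d *: w); rewrite fZ !normrM normrZ !(gtr0_norm d0).
  by rewrite -[d^-1]mul1r ler_pdivlMr// [_ * d]mulrC; apply; rewrite ler_piMr// ltW.
exists (`|v|^-1 *: v) => /=.
  by rewrite normrZ normfV normr_id mulVf// normr_eq0.
by rewrite fZ !normrM normfV !normr_id mulrC.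
Qed.

End Duality.

(** * Existence and uniform continuity of the duality map *)

Section SmoothDuality.
Context {R : realType} {X : normedModType R}.
Hypothesis X_smooth : uniformly_smooth X.
Implicit Types (x y z v w : X).

(* [gat x] is the one-sided directional derivative of the norm at a unit vector
   [x]; smoothness makes it linear, which yields duality functionals without
   the Hahn-Banach theorem. *)
Let quo x y (t : R) : R := (`|x + t *: y| - 1) / t.
Let gat x y : R := inf [set quo x y t | t in [set t : R | 0 < t]].

Let quo_ge x y t : `|x| = 1 -> 0 < t -> - `|y| <= quo x y t.
Proof.
move=> x1 t0; rewrite /quo ler_pdivlMr// lerBrDr.
have := ler_normB (x + t *: y) (t *: y).
rewrite addrK x1 normrZ gtr0_norm//; lra.
Qed.

Let quo_le x y t : `|x| = 1 -> 0 < t -> quo x y t <= `|y|.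
Proof.
move=> x1 t0; rewrite /quo ler_pdivrMr//.
have := ler_normD x (t *: y).
rewrite x1 normrZ gtr0_norm//; lra.
Qed.

(** Convexity of the norm: [t *: (x + s *: y)] splits as [(t - s) *: x + s *: (x + t *: y)]. *)
Let quo_mono x y s t : `|x| = 1 -> 0 < s -> s <= t -> quo x y s <= quo x y t.
Proof.
move=> x1 s0 st; have t0 : 0 < t by exact: lt_le_trans st.
rewrite /quo ler_pdivrMr// mulrAC ler_pdivlMr//.
have := ler_normD ((t - s) *: x) (s *: (x + t *: y)).
have -> : (t - s) *: x + s *: (x + t *: y) = t *: (x + s *: y).
  by rewrite !scalerDr addrA -scalerDl subrK !scalerA [s * t]mulrC.
rewrite !normrZ x1 (gtr0_norm t0) (gtr0_norm s0) ger0_norm ?subr_ge0//; nra.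
Qed.

Let gat_le x y t : `|x| = 1 -> 0 < t -> gat x y <= quo x y t.
Proof.
move=> x1 t0; apply: ge_inf; last by exists t.
by exists (- `|y|) => _ [s /= s0 <-]; exact: quo_ge.
Qed.

Let le_gat x y (c : R) : (forall t, 0 < t -> c <= quo x y t) -> c <= gat x y.
Proof.
move=> h; apply: lb_le_inf; first by exists (quo x y 1), 1 => /=.
by move=> _ [t /= t0 <-]; exact: h.
Qed.

(** By monotonicity both quotients may be taken at a common step [r]; the midpoint of [x + r *: y]
    and [x + r *: z] is [x + (r / 2) *: (y + z)]. *)
Let gat_subadd x y z : `|x| = 1 -> gat x (y + z) <= gat x y + gat x z.
Proof.
move=> x1; rewrite -lerBlDr; apply: le_gat => s s0.
rewrite lerBlDr -lerBlDl; apply: le_gat => t t0.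
rewrite lerBlDl.
set r := Num.min s t.
have r0 : 0 < r by rewrite lt_min s0.
have r20 : 0 < r / 2 by rewrite divr_gt0.
apply: (@le_trans _ _ (quo x y r + quo x z r)); last first.
  by apply: lerD; apply: quo_mono => //; rewrite ge_min lexx ?orbT.
apply: (le_trans (gat_le _ x1 r20)).
rewrite /quo -mulrDl ler_pdivrMr// mulrA mulfVK ?gt_eqF//.
have := ler_normD (x + r *: y) (x + r *: z).
have -> : x + r *: y + (x + r *: z) = 2 *: (x + (r / 2) *: (y + z)).
  rewrite scalerDr scalerA mulrC mulfVK ?pnatr_eq0// scaler_nat mulr2n scalerDr.
  by rewrite addrACA.
rewrite normrZ ger0_norm//; lra.
Qed.

(** Smoothness enters here: it makes the sum of the quotients in the directions [y] and [- y]
    arbitrarily small. The other inequality is subadditivity. *)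
Let gatN x y : `|x| = 1 -> gat x (- y) = - gat x y.
Proof.
move=> x1; apply/eqP; rewrite eq_le; apply/andP; split; last first.
  have := gat_subadd y (- y) x1; rewrite subrr.
  have : 0 <= gat x 0.
    by apply: le_gat => t _; rewrite /quo scaler0 addr0 x1 subrr mul0r.
  lra.
suff : gat x (- y) + gat x y <= 0 by lra.
apply/ler_addgt0Pr => e e0; rewrite add0r.
have y1 : 0 < `|y| + 1 by rewrite ltr_wpDl.
have e'0 : 0 < e / (`|y| + 1) by rewrite divr_gt0.
have [d d0 hd] := X_smooth e'0.
pose t := d / (`|y| + 1).
have t0 : 0 < t by rewrite divr_gt0.
have ty : `|t *: y| <= d.
  by rewrite normrZ gtr0_norm// /t mulrAC ler_pdivrMr// ler_pM2l// lerDl.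
have := hd x (t *: y) x1 ty.
have := gat_le y x1 t0; have := gat_le (- y) x1 t0.
rewrite /quo scalerN !ler_pdivlMr// normrZ (gtr0_norm t0) => h1 h2 h3.
have : t * (gat x (- y) + gat x y) <= t * (e / (`|y| + 1) * `|y|) by lra.
rewrite ler_pM2l// => /le_trans; apply.
by rewrite mulrAC ler_pdivrMr// ler_pM2l// lerDl.
Qed.

Let gatD x y z : `|x| = 1 -> gat x (y + z) = gat x y + gat x z.
Proof.
move=> x1; apply/eqP; rewrite eq_le gat_subadd//=.
have := gat_subadd (y + z) (- z) x1; rewrite addrK gatN//; lra.
Qed.

Let gat0 x : `|x| = 1 -> gat x 0 = 0.
Proof. by move=> x1; have := gatD 0 0 x1; rewrite addr0; lra. Qed.

(** Rescaling the step gives the inequality [key]; applied to [b] and to [b^-1] it yields equality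
    for positive scalars, and [gatN] covers negative ones. *)
Let gatZ x (a : R) y : `|x| = 1 -> gat x (a *: y) = a * gat x y.
Proof.
move=> x1.
have key b v : 0 < b -> gat x (b *: v) <= b * gat x v.
  move=> b0; rewrite -ler_pdivrMl//; apply: le_gat => t t0.
  rewrite ler_pdivrMl//.
  have tb : 0 < t / b by rewrite divr_gt0.
  apply: (le_trans (gat_le _ x1 tb)).
  rewrite /quo scalerA mulfVK ?gt_eqF// invf_div mulrA [leRHS]mulrA.
  by rewrite [b * _]mulrC.
have pos b v : 0 < b -> gat x (b *: v) = b * gat x v.
  move=> b0; apply/eqP; rewrite eq_le key//=.
  have bV : 0 < b^-1 by rewrite invr_gt0.
  have := key _ (b *: v) bV; rewrite scalerA mulVf ?gt_eqF// scale1r.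
  by rewrite ler_pdivlMl.
have [a0|a0|->] := ltgtP a 0; last by rewrite scale0r mul0r gat0.
- have -> : a *: y = - ((- a) *: y) by rewrite scaleNr opprK.
  by rewrite gatN// pos ?oppr_gt0// mulNr opprK.
- exact: pos.
Qed.

Lemma duality_set_neq0 x : duality_set x !=set0.
Proof.
have [->|x0] := eqVneq x 0.
  exists (fun=> 0); apply: duality_setP => [a u v||v]; rewrite ?normr0 ?mul0r//.
  - by rewrite scaler0 addr0.
  - by rewrite expr0n.
have xp : 0 < `|x| by rewrite normr_gt0.
pose e := `|x|^-1 *: x.
have e1 : `|e| = 1 by rewrite /e normrZ normfV normr_id mulVf ?gt_eqF.
exists (fun v => `|x| * gat e v); apply: duality_setP => [a u v||v].
- by rewrite gatD// gatZ// mulrDr mulrCA.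
- have -> : x = `|x| *: e by rewrite /e scalerA divff ?gt_eqF// scale1r.
  rewrite gatZ// normrZ normr_id e1 mulr1.
  suff -> : gat e e = 1 by rewrite mulr1 expr2.
  have qe t : 0 < t -> quo e e t = 1.
    move=> t0; rewrite /quo; have -> : e + t *: e = (1 + t) *: e by rewrite scalerDl scale1r.
    rewrite normrZ e1 mulr1.
    by rewrite ger0_norm ?addr_ge0 ?ltW// addrC addKr divff ?gt_eqF.
  apply/eqP; rewrite eq_le; apply/andP; split.
    by rewrite -[leRHS](qe 1)//; exact: gat_le.
  by apply: le_gat => t t0; rewrite qe.
- rewrite normrM normr_id ler_pM2l// ler_norml; apply/andP; split.
    by apply: le_gat => t t0; exact: quo_ge.
  by apply: le_trans (gat_le _ e1 ltr01) _; exact: quo_le.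
Qed.

Lemma duality_mapP x : duality_set x (duality_map x).
Proof. by have [f fx] := duality_set_neq0 x; exact: (xgetPex _ (ex_intro _ f fx)). Qed.

Lemma duality_map_norm x v : `|duality_map x v| <= `|x| * `|v|.
Proof. exact/duality_set_bound/duality_mapP. Qed.

Lemma duality_map_le x v : duality_map x v <= `|x| * `|v|.
Proof. exact/(le_trans (ler_norm _))/duality_map_norm. Qed.

Lemma duality_map_id x : duality_map x x = `|x| ^+ 2.
Proof. by have [] := duality_mapP x. Qed.

Lemma duality_map_linear x : linear (duality_map x).
Proof. by have [[]] := duality_mapP x. Qed.

Lemma duality_mapDZ x (a : R) v w :
  duality_map x (v + a *: w) = duality_map x v + a * duality_map x w.
Proof. by rewrite addrC duality_map_linear addrC. Qed.

Lemma duality_map0 x : duality_map x 0 = 0.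
Proof.
by have := duality_map_norm x 0; rewrite normr0 mulr0 normr_le0 => /eqP.
Qed.

Lemma duality_mapZ x (a : R) v : duality_map x (a *: v) = a * duality_map x v.
Proof. by have := duality_mapDZ x a 0 v; rewrite duality_map0 !add0r. Qed.

Lemma duality_mapB x v w :
  duality_map x (v - w) = duality_map x v - duality_map x w.
Proof. by rewrite -scaleN1r duality_mapDZ mulN1r. Qed.

Lemma duality_mapD x v w :
  duality_map x (v + w) = duality_map x v + duality_map x w.
Proof. by rewrite -[w]scale1r duality_mapDZ mul1r scale1r. Qed.

(* For unit x, x' with norming functionals f, g and a unit y:
   t (f - g)(y) = f (x + t y) - f x + g (x - t y) - g x
   <= |x + t y| + |x - t y| - 2 + |x - x'|. *)
Lemma duality_map_unif (r C e : R) : 0 < e -> 0 <= C -> 0 <= r ->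
  exists2 d : R, 0 < d & forall z w y, `|z| <= r -> `|y| <= C ->
    `|z - w| <= d -> duality_map z y <= duality_map w y + e.
Proof.
move=> e0 C0 r0.
have r1 : 0 < r + 1 by rewrite ltr_wpDl.
have C1 : 0 < C + 1 by rewrite ltr_wpDl.
pose e' := e / (2 * ((r + 1) * (C + 1))).
have e'0 : 0 < e' by rewrite divr_gt0// !mulr_gt0.
have [d d0 hd] := X_smooth e'0.
pose t := d / (C + 1).
have t0 : 0 < t by rewrite divr_gt0.
have h1 : 0 < e * t / 8 by rewrite divr_gt0// mulr_gt0.
have h2 : 0 < e / (4 * (C + 1)) by rewrite divr_gt0// mulr_gt0.
(* Error budget with [h = |z - w|]: the smoothness term takes [e / 2], the term [2 * h / t] takes
   [e / 4], and [C * h] takes [e / 4]. *)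
exists (Num.min (e * t / 8) (e / (4 * (C + 1)))); first by rewrite lt_min h1.
move=> z w y zr yC; rewrite le_min => /andP[k1 k2].
set h := `|z - w| in k1 k2.
have h0 : 0 <= h by exact: normr_ge0.
have hC : C * h <= e / 4.
  apply: (@le_trans _ _ ((C + 1) * h)); first by rewrite ler_wpM2r// lerDl.
  have -> : e / 4 = (C + 1) * (e / (4 * (C + 1))).
    by rewrite invfM; field; rewrite gt_eqF.
  by rewrite ler_pM2l.
have y0 : 0 <= `|y| by exact: normr_ge0.
(* If [z] or [w] vanishes there is nothing to normalize, but the other vector then has norm [h] and
   the pairings are at most [C * h]. *)
have [z0|z0] := eqVneq z 0.
  have hw : h = `|w| by rewrite /h z0 sub0r normrN.
  have := duality_map_le z y; have := duality_map_le w (- y).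
  rewrite -scaleN1r duality_mapZ normrZ normrN1 -hw z0 normr0; nra.
have [w0|w0] := eqVneq w 0.
  have hw : h = `|z| by rewrite /h w0 subr0.
  have := duality_map_le z y; have := duality_map_le w (- y).
  rewrite -scaleN1r duality_mapZ normrZ normrN1 -hw w0 normr0; nra.
have a0 : 0 < `|z| by rewrite normr_gt0.
have b0 : 0 < `|w| by rewrite normr_gt0.
have ab : `|w| <= `|z| + h.
  by have := ler_normD z (w - z); rewrite addrC subrK distrC.
have ba : `|z| <= `|w| + h.
  by have := ler_normD w (z - w); rewrite addrC subrK.
pose x := `|z|^-1 *: z.
have x1 : `|x| = 1 by rewrite /x normrZ normfV normr_id mulVf ?gt_eqF.
have tyd : `|t *: y| <= d.
  rewrite normrZ gtr0_norm// /t mulrAC ler_pdivrMr// ler_pM2l//.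
  by rewrite (le_trans yC)// lerDl.
have := hd _ _ x1 tyd; rewrite normrZ (gtr0_norm t0).
have := duality_map_le z (x + t *: y).
rewrite duality_mapD !duality_mapZ duality_map_id.
have -> : `|z|^-1 * `|z| ^+ 2 = `|z| by field; rewrite gt_eqF.
have := duality_map_le w (x - t *: y).
rewrite duality_mapB !duality_mapZ.
have gz : `|w| * (`|w| - h) <= duality_map w z.
  have := duality_map_le w (w - z); rewrite duality_mapB duality_map_id.
  rewrite distrC -/h; lra.
set p1 := `|x + t *: y|; set p2 := `|x - t *: y|.
(* [G] is the value at [y] of the norm-one functional in the direction of [w]. *)
pose G := duality_map w y / `|w|.
have gG : duality_map w y = `|w| * G by rewrite mulrC mulfVK ?gt_eqF.
have GC : `|G| <= C.
  rewrite normrM normfV normr_id ler_pdivrMr// mulrC.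
  by apply: (le_trans (duality_map_norm _ _)); rewrite ler_pM2l.
rewrite gG => gw fz p12.
have {}gw : `|z| - 2 * h - t * `|z| * G <= `|z| * p2.
  have : `|z|^-1 * (`|w| * (`|w| - h)) - t * (`|w| * G) <= `|w| * p2.
    by apply: le_trans gw; rewrite lerD2r ler_pM2l ?invr_gt0.
  have -> : `|z|^-1 * (`|w| * (`|w| - h)) - t * (`|w| * G)
     = `|w| * ((`|w| - h) / `|z| - t * G) by ring.
  rewrite ler_pM2l// -(ler_pM2l a0).
  have -> : `|z| * ((`|w| - h) / `|z| - t * G) = `|w| - h - t * `|z| * G.
    by field; rewrite gt_eqF.
  lra.
have aG : `|z| * G <= `|w| * G + h * C.
  have : (`|z| - `|w|) * G <= h * C; last by lra.
  apply: (le_trans (ler_norm _)); rewrite normrM ler_pM//.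
  by rewrite ler_norml; apply/andP; split; lra.
have big : t * duality_map z y <= t * (`|z| * G) + `|z| * (e' * (t * C)) + 2 * h.
  have : `|z| * (p1 + p2) <= `|z| * (2 + e' * (t * C)).
    rewrite ler_pM2l// (le_trans p12)// lerD2l ler_pM2l// ler_pM2l//.
  lra.
have zeC : `|z| * (e' * C) <= e / 2.
  have -> : e / 2 = (r + 1) * (e' * (C + 1)).
    by rewrite /e' !invfM; field; rewrite !gt_eqF.
  apply: ler_pM => //; first by rewrite mulr_ge0// ltW.
  - by rewrite (le_trans zr)// lerDl.
  - by rewrite ler_pM2l// lerDl.
rewrite -(ler_pM2l t0).
have : t * (`|z| * G) <= t * (`|w| * G + h * C) by rewrite ler_pM2l.
have : t * (`|z| * (e' * C)) <= t * (e / 2) by rewrite ler_pM2l.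
have : t * (C * h) <= t * (e / 4) by rewrite ler_pM2l.
lra.
Qed.

End SmoothDuality.

(** * Resolvent iterates and Kobayashi's estimate *)

Section Semigroup.
Context {R : realType} {X : completeNormedModType R}.
Hypothesis X_smooth : uniformly_smooth X.
Variable A : X -> set X.
Hypothesis A_maccretive : m_accretive A.
Implicit Types (x y z v w q : X) (l k t s e c : R).

Let J := resolvent A.
Let dmap_le := duality_map_le X_smooth.
Let dmapD := duality_mapD X_smooth.
Let dmapB := duality_mapB X_smooth.
Let dmapZ := duality_mapZ X_smooth.
Let dmap_id := duality_map_id X_smooth.

Lemma resolvent0 x : resolvent A 0 x = x.
Proof.
rewrite /resolvent; case: xgetP => [z zx [y _]|//].
by rewrite scale0r addr0 zx.
Qed.

Lemma resolventP l x : 0 < l -> A (resolvent A l x) (l^-1 *: (x - resolvent A l x)).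
Proof.
move=> l0; have [z _ zx] : op_ran (id_plus l A) x by rewrite (A_maccretive.2 _ l0).
have := xgetPex x (ex_intro [set z | id_plus l A z x] z zx).
rewrite -/(resolvent A l x) /=; move: (resolvent A l x) => r [y Ay <-].
by rewrite addrC addKr scalerA mulVf ?gt_eqF// scale1r.
Qed.

(** Pairing the right-hand vector with the duality map at [x1 - x2] gives at least [|x1 - x2| ^+ 2],
    by accretivity. *)
Lemma accretive_expand l x1 y1 x2 y2 : 0 <= l -> A x1 y1 -> A x2 y2 ->
  `|x1 - x2| <= `|x1 - x2 + l *: (y1 - y2)|.
Proof.
move=> l0 A1 A2; have [->|w0] := eqVneq (x1 - x2) 0; first by rewrite normr0.
have wp : 0 < `|x1 - x2| by rewrite normr_gt0.
rewrite -(ler_pM2l wp) -expr2.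
apply: le_trans (dmap_le _ _).
by rewrite dmapD dmapZ dmap_id lerDl mulr_ge0// (A_maccretive.1 _ _ _ _ A1 A2).
Qed.

(** With [w = x1 - x2], pair [w + l *: y1] and [w - k *: y2] with the duality map at [w] and weight
    them by [k] and [l]: beyond [(l + k) * |w| ^+ 2] only [k * l] times the nonnegative pairing of
    [y1 - y2] remains. This drives the double induction in [kobayashi]. *)
Lemma accretive_step l k x1 y1 x2 y2 : 0 <= l -> 0 <= k -> A x1 y1 -> A x2 y2 ->
  (l + k) * `|x1 - x2| <=
    k * `|x1 + l *: y1 - x2| + l * `|x1 - (x2 + k *: y2)|.
Proof.
move=> l0 k0 A1 A2; have [->|w0] := eqVneq (x1 - x2) 0.
  by rewrite normr0 mulr0 addr_ge0// mulr_ge0.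
have wp : 0 < `|x1 - x2| by rewrite normr_gt0.
rewrite addrAC opprD addrA.
have h1 := dmap_le (x1 - x2) (x1 - x2 + l *: y1).
have h2 := dmap_le (x1 - x2) (x1 - x2 - k *: y2).
have := A_maccretive.1 _ _ _ _ A1 A2; rewrite dmapB => h3.
move: h1 h2 h3; move: (x1 - x2) wp => w wp.
rewrite dmapB !dmapD !dmapZ dmap_id => h1 h2 h3.
move: (`|w + _|) (`|w - _|) h1 h2 => P Q h1 h2; rewrite -(ler_pM2l wp).
have := ler_wpM2l k0 h1; have := ler_wpM2l l0 h2.
have := mulr_ge0 (mulr_ge0 k0 l0) h3; lra.
Qed.

Lemma resolvent_nonexp l x y : 0 <= l ->
  `|resolvent A l x - resolvent A l y| <= `|x - y|.
Proof.
rewrite le_eqVlt => /predU1P[<-|l0]; first by rewrite !resolvent0.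
apply: le_trans (accretive_expand (ltW l0) (resolventP x l0) (resolventP y l0)) _.
rewrite -scalerBr scalerA divff ?gt_eqF// scale1r.
move: (resolvent A l x) (resolvent A l y) => a b.
by rewrite [x - a]addrC -[- a + x - _]addrA addrACA subrr add0r opprB addrCA addKr.
Qed.

Lemma iter_resolvent_nonexp l x y n : 0 <= l ->
  `|iter n (resolvent A l) x - iter n (resolvent A l) y| <= `|x - y|.
Proof.
move=> l0; elim: n => //= n; exact/le_trans/resolvent_nonexp.
Qed.

Lemma resolvent_dist l x y : 0 <= l -> A x y -> `|x - resolvent A l x| <= l * `|y|.
Proof.
rewrite le_eqVlt => /predU1P[<-|l0] Axy; first by rewrite resolvent0 subrr normr0 mul0r.
have := A_maccretive.1 _ _ _ _ Axy (resolventP x l0).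
set w := x - _; rewrite dmapB dmapZ dmap_id subr_ge0 ler_pdivrMl// => h.
have [->|w0] := eqVneq w 0; first by rewrite normr0 mulr_ge0// ltW.
have wp : 0 < `|w| by rewrite normr_gt0.
rewrite -(ler_pM2l wp) -expr2 (le_trans h)// mulrCA ler_pM2l//.
Qed.

Lemma resolvent_zero l q : 0 <= l -> zeros A q -> resolvent A l q = q.
Proof.
move=> l0 Aq; have := resolvent_dist l0 Aq.
by rewrite normr0 mulr0 normr_le0 subr_eq0 => /eqP.
Qed.

Lemma iter_resolvent_zero l q n : 0 <= l -> zeros A q ->
  iter n (resolvent A l) q = q.
Proof. by move=> l0 Aq; elim: n => //= n ->; exact: resolvent_zero. Qed.

(** The difference quotient of each resolvent step is an element of [A] at the new iterate, and
    [resolvent_dist] shows that its norm does not grow. *)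
Lemma iter_resolvent_bound l x y n : 0 <= l -> A x y ->
  exists2 v, A (iter n (resolvent A l) x) v & `|v| <= `|y|.
Proof.
rewrite le_eqVlt => /predU1P[<-|l0] Axy.
  by exists y => //; elim: n => //= n; rewrite resolvent0.
elim: n => [|n [v Av vy]]; first by exists y.
exists (l^-1 *: (iter n (resolvent A l) x - iter n.+1 (resolvent A l) x)).
  exact: resolventP.
rewrite normrZ gtr0_norm ?invr_gt0// ler_pdivrMl//.
apply: (le_trans (resolvent_dist (ltW l0) Av)).
by rewrite ler_pM2l.
Qed.

Lemma iter_resolvent_step l x y n : 0 <= l -> A x y ->
  `|iter n (resolvent A l) x - iter n.+1 (resolvent A l) x| <= l * `|y|.
Proof.
move=> l0 /(iter_resolvent_bound n l0)[v Av vy].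
by apply: (le_trans (resolvent_dist l0 Av)); rewrite ler_wpM2l.
Qed.

Lemma iter_resolvent_dist l x y n : 0 <= l -> A x y ->
  `|iter n (resolvent A l) x - x| <= n%:R * l * `|y|.
Proof.
move=> l0 Axy; elim: n => [|n IH]; first by rewrite subrr normr0 !mul0r.
have := iter_resolvent_step n l0 Axy; rewrite distrC => h.
have := ler_distD (iter n (resolvent A l) x) (iter n.+1 (resolvent A l) x) x.
rewrite -natr1; lra.
Qed.

(** The squared gap between the times [m * l] and [n * k], plus one discretization error for each
    grid. *)
Let kob l k (m n : nat) : R :=
  (m%:R * l - n%:R * k) ^+ 2 + m%:R * l ^+ 2 + n%:R * k ^+ 2.

Let kob_ge0 l k m n : 0 <= kob l k m n.
Proof. by rewrite /kob !addr_ge0// ?sqr_ge0// mulr_ge0// sqr_ge0. Qed.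

Let kob_base l k m n : 0 <= m%:R * l - n%:R * k ->
  m%:R * l - n%:R * k <= Num.sqrt (kob l k m n).
Proof.
move=> h; rewrite -[leLHS]ger0_norm// -sqrtr_sqr ler_wsqrtr//.
by rewrite /kob -addrA lerDl addr_ge0// mulr_ge0// sqr_ge0.
Qed.

Let kobC l k m n : kob l k m n = kob k l n m.
Proof. by rewrite /kob; ring. Qed.

(* The bound squared satisfies the recursion of [accretive_step] with equality,
   and the square root is concave. *)
Lemma kobayashi l k x y m n : 0 <= l -> 0 <= k -> A x y ->
  `|iter m (resolvent A l) x - iter n (resolvent A k) x| <=
   `|y| * Num.sqrt ((m%:R * l - n%:R * k) ^+ 2 + m%:R * l ^+ 2 + n%:R * k ^+ 2).
Proof.
move=> l0 k0 Axy; rewrite -/(kob l k m n).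
(* The boundary of the induction: one of the two trajectories stays at [x], having no steps or steps
   of length 0. *)
have base a b i j : 0 <= a -> j%:R * b = 0 ->
    `|iter i (resolvent A a) x - x| <= `|y| * Num.sqrt (kob a b i j).
  move=> a0 jb; apply: (le_trans (iter_resolvent_dist i a0 Axy)).
  rewrite mulrC ler_wpM2l//; apply: le_trans (kob_base _); rewrite jb subr0//.
  by rewrite mulr_ge0.
have iter0 (i : nat) : iter i (resolvent A 0) x = x.
  by elim: i => //= i ->; rewrite resolvent0.
move: k0; rewrite le_eqVlt => /predU1P[<-|k0].
  by rewrite iter0 base// mulr0.
move: l0; rewrite le_eqVlt => /predU1P[<-|l0].
  by rewrite iter0 distrC kobC base// ?mulr0// ltW.
elim: m n => [|m IHm] n.
  by rewrite /= distrC kobC base// ?mul0r// ltW.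
elim: n => [|n IHn].
  by apply: (base l k m.+1 0%N); rewrite ?mul0r// ltW.
have := accretive_step (ltW l0) (ltW k0) (resolventP (iter m (J l) x) l0)
  (resolventP (iter n (J k) x) k0).
rewrite !scalerA !divff ?gt_eqF// !scale1r.
rewrite !subrKC -!iterS => h.
have {}IHm := IHm n.+1.
set a := kob l k m n.+1 in IHm.
set b := kob l k m.+1 n in IHn.
have lk : 0 < l + k by exact: addr_gt0.
rewrite -(ler_pM2l lk); apply: (le_trans h).
have h1 : k * `|iter m (J l) x - iter n.+1 (J k) x| <= k * (`|y| * Num.sqrt a).
  by rewrite ler_pM2l.
have h2 : l * `|iter m.+1 (J l) x - iter n (J k) x| <= l * (`|y| * Num.sqrt b).
  by rewrite ler_pM2l.
apply: (le_trans (lerD h1 h2)).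
have -> : k * (`|y| * Num.sqrt a) + l * (`|y| * Num.sqrt b) =
  `|y| * (k * Num.sqrt a + l * Num.sqrt b) by ring.
rewrite mulrCA ler_wpM2l//.
have -> : l + k = Num.sqrt ((l + k) ^+ 2) by rewrite sqrtr_sqr gtr0_norm.
rewrite -sqrtrM ?sqr_ge0// -[leLHS]ger0_norm; last first.
  by rewrite addr_ge0// mulr_ge0// ?sqrtr_ge0// ltW.
rewrite -sqrtr_sqr ler_wsqrtr//.
have ca := sqr_sqrtr (kob_ge0 l k m n.+1); rewrite -/a in ca.
have cb := sqr_sqrtr (kob_ge0 l k m.+1 n); rewrite -/b in cb.
have : (l + k) * (k * a + l * b) = (l + k) ^+ 2 * kob l k m.+1 n.+1.
  by rewrite /a /b /kob -!natr1; ring.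
have := sqr_ge0 (Num.sqrt a - Num.sqrt b).
move: ca cb; set sa := Num.sqrt a; set sb := Num.sqrt b => <- <- h3 h4.
(* Concavity of the square root, made explicit: the defect is the square
   [k * l * (sa - sb) ^+ 2]. *)
have -> : (l + k) ^+ 2 * kob l k m.+1 n.+1 =
  (k * sa + l * sb) ^+ 2 + k * l * (sa - sb) ^+ 2 by rewrite -h4; ring.
by rewrite lerDl mulr_ge0// mulr_ge0// ltW.
Qed.

End Semigroup.

(** * The exponential formula and its approximation on grids *)

Lemma div_nat_small {R : realType} (a e : R) : 0 <= a -> 0 < e ->
  exists N : nat, forall n, (N < n)%N -> a / n%:R <= e.
Proof.
move=> a0 e0; exists (Num.truncn (a / e)) => n Nn.
have n0 : 0 < n%:R :> R by rewrite ltr0n (leq_ltn_trans _ Nn).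
rewrite ler_pdivrMr// -ler_pdivrMl// mulrC.
by rewrite ltW// -truncn_lt_nat// divr_ge0// ltW.
Qed.

Section SemigroupLimit.
Context {R : realType} {X : completeNormedModType R}.
Hypothesis X_smooth : uniformly_smooth X.
Variable A : X -> set X.
Hypothesis A_maccretive : m_accretive A.
Implicit Types (x y z v w q : X) (l k t s e c : R).

Let E t x (n : nat) : X := iter n (resolvent A (t / n%:R)) x.

(** The grid of step [t / n] reaches time [t] exactly after [n] steps, with discretization error
    [t ^+ 2 / n]. *)
Let E_dist l t x y i n : 0 <= l -> 0 <= t -> (0 < n)%N -> A x y ->
  `|E t x n - iter i (resolvent A l) x| <=
    `|y| * Num.sqrt ((t - i%:R * l) ^+ 2 + i%:R * l ^+ 2 + t ^+ 2 / n%:R).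
Proof.
move=> l0 t0 n0 Axy; have nR : 0 < n%:R :> R by rewrite ltr0n.
have tn : 0 <= t / n%:R by rewrite divr_ge0// ltW.
rewrite distrC; apply: (le_trans (kobayashi X_smooth A_maccretive i n l0 tn Axy)).
have -> // : (i%:R * l - n%:R * (t / n%:R)) ^+ 2 + i%:R * l ^+ 2 +
   n%:R * (t / n%:R) ^+ 2 =
   (t - i%:R * l) ^+ 2 + i%:R * l ^+ 2 + t ^+ 2 / n%:R.
by field; rewrite gt_eqF.
Qed.

Let E_nonexp t x z n : 0 <= t -> `|E t x n - E t z n| <= `|x - z|.
Proof.
move=> t0; apply: (iter_resolvent_nonexp X_smooth A_maccretive).
by rewrite divr_ge0.
Qed.

Let closure_approx x e : closure (op_dom A) x -> 0 < e ->
  exists z y, A z y /\ `|x - z| <= e.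
Proof.
move=> cx e0; have [z [[y Azy] xz]] := cx _ (nbhsx_ballx x e e0).
exists z, y; split => //; apply: ltW.
by move: xz; rewrite -ball_normE.
Qed.

(** For a domain point [z] near [x], two approximants both end at time [t], so only the
    discretization errors separate them; nonexpansiveness carries the Cauchy property over to
    [x]. *)
Let E_cvg t x : 0 <= t -> closure (op_dom A) x -> cvgn (E t x).
Proof.
move=> t0 cx; apply/cauchy_cvgP; apply: cauchy_exP => _/posnumP[e].
have [|z [y [Azy xz]]] := closure_approx (e := e%:num / 4) cx; first by [].
have y1 : 0 < `|y| + 1 by rewrite ltr_wpDl.
pose c := e%:num / (4 * (`|y| + 1)).
have c0 : 0 < c by rewrite divr_gt0// mulr_gt0.
have [|N hN] := @div_nat_small _ (t ^+ 2) (c ^+ 2 / 2) (sqr_ge0 _).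
  by rewrite divr_gt0// exprn_gt0.
have hE (n : nat) : (N < n)%N -> `|E t z n - E t z N.+1| <= e%:num / 4.
  move=> Nn; have n0 : (0 < n)%N by exact: leq_ltn_trans Nn.
  have tN : 0 <= t / N.+1%:R by rewrite divr_ge0.
  apply: (le_trans (E_dist N.+1 tN t0 n0 Azy)).
  have -> : t - N.+1%:R * (t / N.+1%:R) = 0 by field; rewrite nat1r pnatr_eq0.
  have -> : N.+1%:R * (t / N.+1%:R) ^+ 2 = t ^+ 2 / N.+1%:R.
    by field; rewrite nat1r pnatr_eq0.
  rewrite expr0n add0r.
  apply: (@le_trans _ _ ((`|y| + 1) * Num.sqrt (c ^+ 2))); last first.
    rewrite sqrtr_sqr gtr0_norm//.
    have -> // : (`|y| + 1) * c = e%:num / 4 by rewrite /c; field; rewrite gt_eqF.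
  rewrite ler_pM ?sqrtr_ge0// ?lerDl// ler_wsqrtr//.
  by rewrite [leRHS]splitr lerD// hN.
exists (E t x N.+1); exists N.+1 => // n /= Nn.
rewrite -ball_normE /=.
have h1 := E_nonexp x z N.+1 t0; have h2 := E_nonexp x z n t0.
have h3 := hE n Nn.
have := ler_distD (E t z N.+1) (E t x N.+1) (E t x n).
have := ler_distD (E t z n) (E t z N.+1) (E t x n).
rewrite [`|E t z N.+1 - E t z n|]distrC [`|E t z n - E t x n|]distrC.
have : 0 < e%:num by []; lra.
Qed.

Let semigroup_near t x e : 0 <= t -> closure (op_dom A) x -> 0 < e ->
  exists N : nat, forall n, (N < n)%N -> `|semigroup A t x - E t x n| <= e.
Proof.
move=> t0 cx e0; have /cvgrPdist_le/(_ e e0)[N _ hN] := E_cvg t0 cx.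
by exists N => n /ltnW Nn; exact: hN.
Qed.

Lemma semigroup_nonexp t x z : 0 <= t ->
  closure (op_dom A) x -> closure (op_dom A) z ->
  `|semigroup A t x - semigroup A t z| <= `|x - z|.
Proof.
move=> t0 cx cz; apply/ler_addgt0Pr => e e0.
have e2 : 0 < e / 2 by rewrite divr_gt0.
have [N hN] := semigroup_near t0 cx e2; have [M hM] := semigroup_near t0 cz e2.
pose n := (maxn N M).+1.
have {}hN : `|semigroup A t x - E t x n| <= e / 2.
  by apply: hN; rewrite ltnS leq_maxl.
have {}hM : `|semigroup A t z - E t z n| <= e / 2.
  by apply: hM; rewrite ltnS leq_maxr.
have h1 := E_nonexp x z n t0.
have := ler_distD (E t x n) (semigroup A t x) (semigroup A t z).
have := ler_distD (E t z n) (E t x n) (semigroup A t z).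
rewrite [`|E t z n - semigroup A t z|]distrC; lra.
Qed.

(** The strict inequality in the hypothesis leaves room for the error [t ^+ 2 / n], which vanishes
    in the limit. *)
Lemma semigroup_dist l t x y i c : 0 <= l -> 0 <= t -> 0 <= c -> A x y ->
  (t - i%:R * l) ^+ 2 + i%:R * l ^+ 2 < c ^+ 2 ->
  `|semigroup A t x - iter i (resolvent A l) x| <= `|y| * c.
Proof.
move=> l0 t0 c0 Axy hc; apply/ler_addgt0Pr => e e0.
have cx : closure (op_dom A) x by apply: subset_closure; exists y.
have [N hN] := semigroup_near t0 cx e0.
have [|M hM] := @div_nat_small _ _
  (c ^+ 2 - ((t - i%:R * l) ^+ 2 + i%:R * l ^+ 2)) (sqr_ge0 t).
  by rewrite subr_gt0.
pose n := (maxn N M).+1.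
have {}hN : `|semigroup A t x - E t x n| <= e.
  by apply: hN; rewrite ltnS leq_maxl.
have {hM} hn : t ^+ 2 / n%:R <= c ^+ 2 - ((t - i%:R * l) ^+ 2 + i%:R * l ^+ 2).
  by apply: hM; rewrite ltnS leq_maxr.
apply: (le_trans (ler_distD (E t x n) _ _)).
rewrite addrC lerD//.
apply: (le_trans (E_dist i l0 t0 (ltn0Sn _) Axy)).
rewrite ler_wpM2l// -[leRHS]ger0_norm// -sqrtr_sqr ler_wsqrtr//.
by rewrite -lerBrDl.
Qed.

(** The grid point just before [t] misses it by less than [l], so for [l <= 1] the squared bound is
    at most [(T + 1) * l], uniformly in [t]. *)
Lemma semigroup_grid x y (T e : R) : A x y -> 0 <= T -> 0 < e ->
  exists2 d, 0 < d & forall l t, 0 < l -> l <= d -> 0 <= t -> t <= T ->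
    `|semigroup A t x - iter (Num.truncn (t / l)) (resolvent A l) x| <= e.
Proof.
move=> Axy T0 e0.
have y1 : 0 < `|y| + 1 by rewrite ltr_wpDl.
have T1 : 0 < T + 1 by rewrite ltr_wpDl.
pose c := e / (`|y| + 1).
have c0 : 0 < c by rewrite divr_gt0.
pose d := c ^+ 2 / (2 * (T + 1)).
have d0 : 0 < d by rewrite divr_gt0 ?exprn_gt0// mulr_gt0.
exists (Num.min 1 d); first by rewrite lt_min ltr01.
move=> l t l0; rewrite le_min => /andP[l1 ld] t0 tT.
have tl : 0 <= t / l by rewrite divr_ge0// ltW.
have /andP[] := truncn_itv tl; set i := Num.truncn _.
rewrite ler_pdivlMr// ltr_pdivrMr// -natr1 => h1 h2.
apply: (@le_trans _ _ (`|y| * c)); last first.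
  rewrite /c mulrCA ger_pMr// ler_pdivrMr// mul1r.
  by rewrite lerDl.
apply: semigroup_dist => //; [exact: ltW|exact: ltW|].
have hh : (T + 1) * l <= c ^+ 2 / 2.
  have -> : c ^+ 2 / 2 = (T + 1) * d.
    by rewrite /d invfM; field; rewrite gt_eqF.
  by rewrite ler_pM2l.
have : (t - i%:R * l) ^+ 2 <= l by nra.
have : i%:R * l ^+ 2 <= T * l.
  rewrite expr2 mulrA ler_pM2r//; lra.
have : 0 < c ^+ 2 by rewrite exprn_gt0.
nra.
Qed.

Lemma iter_resolvent_fejer l x q i j : 0 <= l -> zeros A q -> (i <= j)%N ->
  `|iter j (resolvent A l) x - q| <= `|iter i (resolvent A l) x - q|.
Proof.
move=> l0 Aq ij.
rewrite -(subnK ij) iterD.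
rewrite -{1}(iter_resolvent_zero X_smooth A_maccretive (j - i) l0 Aq).
exact: (iter_resolvent_nonexp X_smooth A_maccretive).
Qed.

(** Monotonicity is inherited from the resolvent iterates: a single grid, starting at a domain point
    near [x], approximates the semigroup at both times. *)
Lemma semigroup_fejer s t x q : closure (op_dom A) x -> zeros A q ->
  0 <= s -> s <= t -> `|semigroup A t x - q| <= `|semigroup A s x - q|.
Proof.
move=> cx Aq s0 st; have t0 := le_trans s0 st.
apply/ler_addgt0Pr => e e0.
have e4 : 0 < e / 4 by rewrite divr_gt0.
have [z [y [Azy xz]]] := closure_approx cx e4.
have cz : closure (op_dom A) z by apply: subset_closure; exists y.
have [l l0 hl] := semigroup_grid Azy t0 e4.
have ht := hl l t l0 (lexx _) t0 (lexx _).
have hs := hl l s l0 (lexx _) s0 st.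
have nt := semigroup_nonexp t0 cx cz.
have ns := semigroup_nonexp s0 cx cz.
have ij : (Num.truncn (s / l) <= Num.truncn (t / l))%N.
  by apply: le_truncn; rewrite ler_pM2r// invr_gt0.
have := iter_resolvent_fejer z (ltW l0) Aq ij.
move: ht hs; set a := iter _ _ z; set b := iter _ _ z => ht hs hab.
have := ler_distD (semigroup A t z) (semigroup A t x) q.
have := ler_distD a (semigroup A t z) q.
have := ler_distD (semigroup A s x) b q.
have := ler_distD (semigroup A s z) b (semigroup A s x).
rewrite [`|b - semigroup A s z|]distrC [`|semigroup A s z - semigroup A s x|]distrC.
lra.
Qed.

End SemigroupLimit.

(** * Uniform convexity and nearest points *)

Lemma half_double {R : realType} {X : normedModType R} (x : X) :
  2^-1 *: (x + x) = x.
Proof.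
rewrite -mulr2n -(scaler_nat 2 x) scalerA mulVf ?pnatr_eq0//.
by rewrite scale1r.
Qed.

Section NearestPoint.
Context {R : realType} {X : completeNormedModType R}.
Hypothesis X_convex : uniformly_convex X.
Implicit Types (a b x y z w : X) (C : set X).

(** After division by [r + d'], a large difference would push the midpoint down to norm
    [(1 - d) * (r + d')], which is below [r] because [d' <= r * d / 2]. *)
Lemma uniformly_convex_scaled (r eps : R) : 0 < r -> 0 < eps ->
  exists2 d : R, 0 < d & forall a b, `|a| <= r + d -> `|b| <= r + d ->
    r <= `|2^-1 *: (a + b)| -> `|a - b| <= eps.
Proof.
move=> r0 e0.
have r1 : 0 < r + 1 by rewrite addr_gt0.
pose e' := Num.min 2 (eps / (r + 1)).
have e'0 : 0 < e' by rewrite lt_min divr_gt0// ltr0n.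
have e'2 : 0 < e' <= 2 by rewrite e'0 ge_min lexx.
have [d d0 hd] := X_convex e'2.
pose d' := Num.min 1 (r * d / 2).
have d'0 : 0 < d' by rewrite lt_min ltr01 divr_gt0// mulr_gt0.
have d'1 : d' <= 1 by rewrite ge_min lexx.
have d'r : d' <= r * d / 2 by rewrite ge_min lexx orbT.
exists d' => // a b ar br rab; rewrite leNgt; apply/negP => eab.
have s0 : 0 < r + d' by exact: addr_gt0.
have sc v : `|(r + d')^-1 *: v| = `|v| / (r + d').
  by rewrite normrZ gtr0_norm ?invr_gt0// mulrC.
have := hd ((r + d')^-1 *: a) ((r + d')^-1 *: b).
rewrite -scalerBr -scalerDr scalerA mulrC -scalerA !sc !ler_pdivrMr// !mul1r.
rewrite ler_pdivlMr// => /(_ ar br) h.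
have : `|2^-1 *: (a + b)| <= (1 - d) * (r + d').
  apply: h; apply: le_trans (ltW eab).
  apply: (@le_trans _ _ (eps / (r + 1) * (r + 1))); last by rewrite mulfVK ?gt_eqF.
  apply: ler_pM; [exact: ltW|exact: ltW| |by rewrite lerD2l].
  by rewrite ge_min lexx orbT.
have := mulr_gt0 d0 d'0; have := mulr_gt0 r0 d0; lra.
Qed.

(** A minimizing sequence is Cauchy: midpoints stay in [C], hence at distance at least [d] from [x],
    and uniform convexity brings near-minimizers together. *)
Lemma nearest_point_exists C x : C !=set0 -> closed C ->
  (forall a b, C a -> C b -> C (2^-1 *: (a + b))) ->
  exists z, C z /\ forall w, C w -> `|x - z| <= `|x - w|.
Proof.
move=> [c0 Cc0] Ccl Cmid.
pose D := [set `|x - w| | w in C].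
have lD : has_lbound D by exists 0 => _ [w _ <-].
have hD : has_inf D by split => //; exists `|x - c0|, c0.
pose d := inf D.
have dle w : C w -> d <= `|x - w| by move=> Cw; apply: ge_inf => //; exists w.
have d0 : 0 <= d by apply: lb_le_inf; [exact: hD.1|move=> _ [w _ <-]].
have key eps : 0 < eps -> exists2 e, 0 < e & forall a b, C a -> C b ->
    `|x - a| <= d + e -> `|x - b| <= d + e -> `|a - b| <= eps.
  (* The scaled form of convexity requires a positive radius; at distance 0 the triangle inequality
     suffices. *)
  move=> eps0; move: d0; rewrite le_eqVlt => /predU1P[<-|d0].
    exists (eps / 2); first by rewrite divr_gt0.
    move=> a b _ _ xa xb; have := ler_distD x a b; rewrite [`|a - x|]distrC; lra.
  have [e e0 he] := uniformly_convex_scaled d0 eps0.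
  exists e => // a b Ca Cb xa xb.
  have -> : `|a - b| = `|x - a - (x - b)| by rewrite opprB [X in _ = `|X|]addrC subrKA distrC.
  apply: he => //.
  have -> : 2^-1 *: (x - a + (x - b)) = x - 2^-1 *: (a + b).
    by rewrite addrACA -opprD scalerBr half_double.
  exact/dle/Cmid.
have /choice[w hw] (n : nat) : exists w, C w /\ `|x - w| <= d + n.+1%:R^-1.
  have n0 : 0 < n.+1%:R^-1 :> R by rewrite invr_gt0.
  have [_ [w Cw <-] wd] := inf_adherent n0 hD.
  by exists w; split => //; exact: ltW.
have near_d (e : R) : 0 < e -> exists N, forall n, (N <= n)%N -> `|x - w n| <= d + e.
  move=> e0; exists (Num.truncn e^-1) => n Nn.
  apply: (le_trans (hw n).2); rewrite lerD2l.
  rewrite invf_ple ?posrE// ltW// -truncn_lt_nat// invr_ge0 ltW//.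
have wcvg : cvgn w.
  apply/cauchy_cvgP; apply: cauchy_exP => _/posnumP[e].
  have e2 : 0 < e%:num / 2 by [].
  have [e1 e10 he] := key _ e2.
  have [N hN] := near_d _ e10.
  exists (w N); exists N => // n /= Nn; rewrite -ball_normE /=.
  apply: (@le_lt_trans _ _ (e%:num / 2)).
    by apply: he; [exact: (hw N).1|exact: (hw n).1|exact: hN|exact: hN].
  by rewrite gtr_pMr// invf_lt1 ?ltr1n.
have Cl : C (limn w).
  by apply: (closed_cvg C Ccl _ _ wcvg); apply: nearW => n; exact: (hw n).1.
exists (limn w); split => // v Cv; apply: le_trans (dle _ Cv).
apply/ler_addgt0Pr => e e0.
have e2 : 0 < e / 2 by rewrite divr_gt0.
have [N hN] := near_d _ e2.
have /cvgrPdist_le/(_ _ e2)[M _ hM] := wcvg.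
have := hN (maxn N M) (leq_maxl _ _).
have := hM (maxn N M) (leq_maxr _ _) => /=.
have := ler_distD (w (maxn N M)) x (limn w); rewrite [`|w _ - limn w|]distrC; lra.
Qed.

Lemma nearest_pointP C x : C !=set0 -> closed C ->
  (forall a b, C a -> C b -> C (2^-1 *: (a + b))) ->
  C (nearest_point C x) /\ forall w, C w -> `|x - nearest_point C x| <= `|x - w|.
Proof.
move=> C0 Ccl Cmid; have [z hz] := nearest_point_exists x C0 Ccl Cmid.
exact: (xgetPex x
  (ex_intro [set z | C z /\ forall w, C w -> `|x - z| <= `|x - w|] z hz)).
Qed.

End NearestPoint.

(** * The zero set as the fixed point set of a resolvent *)

Section Zeros.
Context {R : realType} {X : completeNormedModType R}.
Hypothesis X_convex : uniformly_convex X.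
Hypothesis X_smooth : uniformly_smooth X.
Variable A : X -> set X.
Hypothesis A_maccretive : m_accretive A.

Let J := resolvent A 1.

Let J_nonexp x y : `|J x - J y| <= `|x - y|.
Proof. exact: resolvent_nonexp. Qed.

Let zeros_fix q : zeros A q -> J q = q.
Proof. exact: resolvent_zero. Qed.

Let fix_zeros q : J q = q -> zeros A q.
Proof.
by move=> Jq; have := resolventP A_maccretive q ltr01; rewrite -/J Jq subrr scaler0.
Qed.

Lemma zeros_closed : closed (zeros A).
Proof.
move=> q cq; apply: fix_zeros; apply/eqP; rewrite -subr_eq0 -normr_le0.
apply/ler_addgt0Pr => e e0; rewrite add0r.
have e2 : 0 < e / 2 by rewrite divr_gt0.
have [w [Aw]] := cq _ (nbhsx_ballx q _ e2).
rewrite -ball_normE /= => qw.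
have := J_nonexp q w; rewrite (zeros_fix Aw) => h.
have := ler_distD w (J q) q; rewrite [`|w - q|]distrC; lra.
Qed.

(** For the midpoint [m], both [J m - a] and [b - J m] have norm at most [|a - b| / 2], and so does
    their mean, with equality. Uniform convexity makes them equal, and their difference is twice
    [J m - m]. *)
Lemma zeros_midpoint (a b : X) : zeros A a -> zeros A b ->
  zeros A (2^-1 *: (a + b)).
Proof.
move=> Aa Ab; have [<-|ab] := eqVneq a b.
  by rewrite half_double.
set m := 2^-1 *: (a + b).
have m2 : m + m = a + b by rewrite -scalerDr half_double.
have hab : 0 < `|a - b| / 2 by rewrite divr_gt0// normr_gt0 subr_eq0.
have ma : `|m - a| = `|a - b| / 2.
  have -> : m - a = 2^-1 *: (b - a).
    have -> : b - a = (m - a) + (m - a).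
      by rewrite addrACA m2 addrACA subrr add0r.
    by rewrite half_double.
  by rewrite normrZ distrC ger0_norm ?invr_ge0// mulrC.
have mb : `|m - b| = `|a - b| / 2.
  have -> : m - b = 2^-1 *: (a - b).
    have -> : a - b = (m - b) + (m - b).
      by rewrite addrACA m2 addrACA subrr addr0.
    by rewrite half_double.
  by rewrite normrZ ger0_norm ?invr_ge0// mulrC.
apply: fix_zeros; apply/eqP; rewrite -subr_eq0 -normr_le0.
apply/ler_addgt0Pr => e e0; rewrite add0r.
have [d d0 hd] := uniformly_convex_scaled X_convex hab e0.
have h1 := J_nonexp m a; have h2 := J_nonexp m b.
rewrite (zeros_fix Aa) ma in h1; rewrite (zeros_fix Ab) mb distrC in h2.
apply: (@le_trans _ _ `|J m - a - (b - J m)|).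
  have -> : J m - a - (b - J m) = (J m - m) *+ 2.
    by rewrite mulr2n addrACA -opprD m2 opprB addrACA -opprD.
  by rewrite normrMn mulr2n lerDl.
apply: hd; [lra|lra|].
by rewrite [X in _ *: X]addrC subrKA normrZ ger0_norm ?invr_ge0// distrC mulrC.
Qed.

Lemma zero_projP p x : zeros A p -> zeros A (zero_proj A x) /\
  forall w, zeros A w -> `|x - zero_proj A x| <= `|x - w|.
Proof.
move=> Ap; apply: nearest_pointP => //; [by exists p|exact: zeros_closed|].
exact: zeros_midpoint.
Qed.

End Zeros.

(** * Iterates with small pairing and closeness to the zero set *)

Section Convergence.
Context {R : realType} {X : completeNormedModType R}.
Hypothesis X_convex : uniformly_convex X.
Hypothesis X_smooth : uniformly_smooth X.
Variable A : X -> set X.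
Hypothesis A_maccretive : m_accretive A.
Variable p : X.
Hypothesis p_zero : zeros A p.
Implicit Types (x y z v w q : X) (l t e c : R).

Let P := zero_proj A.
Let P_zero x : zeros A (P x).
Proof. by have [] := zero_projP X_convex X_smooth A_maccretive x p_zero. Qed.

Let P_le x q : zeros A q -> `|x - P x| <= `|x - q|.
Proof. by have [_] := zero_projP X_convex X_smooth A_maccretive x p_zero; exact. Qed.

(* Projecting at [z] rather than at the resolvent makes the inequality exact;
   [exists_slow_iterate] then replaces one projection by the other. *)
Lemma resolvent_energy l z :
  2 * duality_map (resolvent A l z - zero_proj A z) (z - resolvent A l z) <=
  `|z - zero_proj A z| ^+ 2 - `|resolvent A l z - zero_proj A (resolvent A l z)| ^+ 2.
Proof.
have := P_le (resolvent A l z) (P_zero z).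
rewrite -/P; set w := resolvent A l z - P z => h.
have -> : z - resolvent A l z = (z - P z) - w by rewrite /w opprB addrA subrK.
rewrite (duality_mapB X_smooth) (duality_map_id X_smooth).
have := duality_map_le X_smooth w (z - P z).
have := sqr_ge0 (`|w| - `|z - P z|).
have : `|resolvent A l z - P (resolvent A l z)| ^+ 2 <= `|w| ^+ 2.
  by rewrite lerXn2r// nnegrE.
lra.
Qed.

(** Otherwise each of the [N] steps would lower the energy by more than [2 * l * c], in total by
    more than the initial [b ^+ 2]. *)
Lemma exists_small_pairing x l c (b : R) (N : nat) :
  0 < l -> `|x - zero_proj A x| <= b -> b ^+ 2 < 2 * (N%:R * l) * c ->
  exists2 i, (i < N)%N & let z := iter i (resolvent A l) x in
    duality_map (resolvent A l z - zero_proj A z)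
      (l^-1 *: (z - resolvent A l z)) <= c.
Proof.
move=> l0 xb bc; apply: contrapT => h.
have hc i : (i < N)%N -> let z := iter i (resolvent A l) x in
    l * c <= duality_map (resolvent A l z - P z) (z - resolvent A l z).
  move=> iN /=; rewrite -ler_pdivlMl//; apply: ltW; rewrite ltNge; apply/negP => hh.
  by apply: h; exists i => //; rewrite /= (duality_mapZ X_smooth).
have : forall n, (n <= N)%N ->
    `|iter n (resolvent A l) x - P (iter n (resolvent A l) x)| ^+ 2
    + 2 * (n%:R * l) * c <= b ^+ 2.
  elim=> [_|n IH nN].
    by rewrite mul0r mulr0 mul0r addr0 lerXn2r// ?nnegrE// (le_trans _ xb).
  have := IH (ltnW nN); have := hc n nN => /=.
  have := resolvent_energy l (iter n (resolvent A l) x).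
  rewrite /= -/P -natr1; lra.
move=> /(_ N (leqnn _)); have := sqr_ge0
  `|iter N (resolvent A l) x - P (iter N (resolvent A l) x)|; lra.
Qed.

Lemma exists_slow_iterate (omega : nat -> nat -> nat) x y (r T : nat) c (d : R) :
  unif_cont_modulus (zero_proj A) p omega ->
  A x y -> `|x - p| <= r%:R -> (0 < T)%N -> 0 < d ->
  r%:R ^+ 2 < 2 * T%:R * c ->
  exists l i v, let z := iter i (resolvent A l) x in
    [/\ 0 < l <= d, i%:R * l <= T%:R, A z v, `|v| <= `|y| &
        `|duality_map (z - zero_proj A z) v| <= c].
Proof.
move=> Pom Axy xp T0 d0 rc.
have TR : 0 < T%:R :> R by rewrite ltr0n.
(* The threshold [c'] lies strictly between [r ^+ 2 / (2 * T)] and [c]; the slack [c - c'] pays for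
   exchanging the projections. *)
pose c' := (c + r%:R ^+ 2 / (2 * T%:R)) / 2.
have rT : r%:R ^+ 2 / (2 * T%:R) < c by rewrite ltr_pdivrMr ?mulr_gt0// mulrC.
have e0 : 0 < c - c' by rewrite /c'; lra.
have c'r : r%:R ^+ 2 < 2 * T%:R * c'.
  by rewrite mulrC -ltr_pdivrMr ?mulr_gt0// /c'; lra.
have [dl dl0 hdl] := duality_map_unif X_smooth e0 (normr_ge0 y) (ler0n R r).
pose k := Num.truncn dl^-1.
have kdl : k.+1%:R^-1 <= dl.
  by rewrite invf_ple ?posrE// ltW// -truncn_lt_nat// invr_ge0 ltW.
pose eta : R := (omega r k).+1%:R^-1.
have eta0 : 0 < eta by rewrite invr_gt0.
(* The step is [l = 1 / M], so [T * M] steps last exactly [T]; [M] is large enough for [l <= d] and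
   for each step to move by at most [eta]. *)
pose M := (Num.truncn (d^-1 + `|y| / eta)).+1.
have M0 : 0 < M%:R :> R by rewrite ltr0n.
have a0 : 0 < d^-1 by rewrite invr_gt0.
have b0 : 0 <= `|y| / eta by rewrite divr_ge0// ltW.
have hM : d^-1 + `|y| / eta <= M%:R.
  by rewrite ltW// -truncn_lt_nat// addr_ge0// ltW.
pose l := M%:R^-1 : R.
have l0 : 0 < l by rewrite invr_gt0.
have ld : l <= d by rewrite /l invf_ple ?posrE// (le_trans _ hM)// lerDl.
have ly : l * `|y| <= eta.
  rewrite /l ler_pdivrMl// -ler_pdivrMr// (le_trans _ hM)//.
  by rewrite lerDr ltW.
have TM : (T * M)%:R * l = T%:R by rewrite natrM mulfK// gt_eqF.
have xPx : `|x - P x| <= r%:R by apply: (le_trans (P_le _ p_zero)).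
have [|i iTM] := @exists_small_pairing x l c' _ (T * M)%N l0 xPx.
  by rewrite TM.
set z := iter i _ x; set z' := resolvent A l z => /= hz.
(* The index is [i.+1] because the small pairing involves the resolvent of the [i]-th iterate. *)
exists l, i.+1, (l^-1 *: (z - z')).
have zp j : `|iter j (resolvent A l) x - p| <= r%:R.
  have := iter_resolvent_fejer X_smooth A_maccretive x (ltW l0) p_zero (leq0n j).
  by move=> h; exact: (le_trans h).
have Az : A z' (l^-1 *: (z - z')) by exact: resolventP.
have vy : `|l^-1 *: (z - z')| <= `|y|.
  rewrite normrZ gtr0_norm ?invr_gt0// ler_pdivrMl//.
  exact: (iter_resolvent_step X_smooth A_maccretive i (ltW l0) Axy).
split => //; first by rewrite l0.
  by rewrite -TM ler_pM2r// ler_nat.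
(* The absolute value is harmless: the pairing is nonnegative by accretivity against the zero
   [P z']. *)
rewrite -/P iterS -/z' ger0_norm; last first.
  have := A_maccretive.1 _ _ _ _ Az (P_zero z').
  by rewrite subr0.
have -> : c = c' + (c - c') by rewrite addrC subrK.
apply: le_trans (hdl _ _ _ _ vy _) _; last by rewrite lerD2r; exact: hz.
- apply: (le_trans (P_le _ p_zero)); exact: (zp i.+1).
- rewrite opprB [X in `|X|]addrC subrKA.
  apply: le_trans kdl; apply: (Pom r); [exact: (zp i)|exact: (zp i.+1)|].
  apply: le_trans ly.
  exact: (iter_resolvent_step X_smooth A_maccretive i (ltW l0) Axy).
Qed.

Lemma chi_mono (B : nat) : {homo chi R B : m n / (m <= n)%N}.
Proof. by move=> m n mn; rewrite /chi leq_mul. Qed.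

(** This makes [chi] a sufficient time horizon for pairing [1 / (n + 1)] and initial distance
    [B + 1]; the summand 1 under the ceiling gives strictness. *)
Lemma chi_gt (B n : nat) :
  (B + 1)%:R ^+ 2 < 2 * (chi R B n)%:R * n.+1%:R^-1 :> R.
Proof.
rewrite /chi natrM mulrA mulfK ?pnatr_eq0//.
set a := 2^-1 * _ + 1.
have a0 : 0 <= a by rewrite addr_ge0// mulr_ge0// sqr_ge0.
have : a <= `|Num.ceil a|%:R.
  have c0 : 0 <= Num.ceil a by rewrite ceil_ge0 (lt_le_trans _ a0)// ltrN10.
  by rewrite natr_absz ger0_norm// ceil_ge.
rewrite /a natrD; lra.
Qed.

(** The zero is the projection of an iterate supplied by the weak modulus. The finite horizon [T]
    fixes in advance how fine the grids must be, and the Fejer property keeps later grid points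
    close to that zero. *)
Lemma semigroup_near_zero (Omega : nat -> (nat -> nat) -> nat -> nat)
    (omega : nat -> nat -> nat) (B K k : nat) (a x y : X) (T : R) :
  weak_modulus A Omega -> unif_cont_modulus (zero_proj A) p omega ->
  closure (op_dom A) a -> `|a - p| <= B%:R ->
  A x y -> `|x - a| <= (3 * k + 2).+1%:R^-1 ->
  `|y| <= K%:R -> B%:R + 1 + `|p| <= K%:R -> 0 <= T ->
  exists2 q, zeros A q & forall t,
    (chi R B (Omega K id (3 * k + 2)%N))%:R <= t -> t <= T ->
    `|semigroup A t a - q| <= k.+1%:R^-1.
Proof.
move=> Om Pom ca ap Axy xa yK BK T0.
(* The accuracy [3 * h] is spent on moving from [a] to [x], on the grid error, and on the distance
   of the iterate to the zero set. *)
have [h hE] : exists h : R, h = (3 * k + 2).+1%:R^-1 by eexists.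
have -> : k.+1%:R^-1 = 3 * h.
  by rewrite hE -addnS [(3 * k)%N]mulnC addnC -mulSn natrM invfM mulrCA
    divff ?mulr1// pnatr_eq0.
have e0 : 0 < h by rewrite hE invr_gt0.
have h1 : h <= 1 by rewrite hE invf_le1 ?ler1n.
rewrite -hE in xa.
have xB : `|x - p| <= (B + 1)%:R.
  have := ler_distD a x p; rewrite [(B + 1)%:R]natrD; lra.
have [d d0 hd] := semigroup_grid X_smooth A_maccretive Axy T0 e0.
(* The step size may change with [n]; the pairing at index [n] is at most [1 / (n + 1)], so [id] is
   a rate of convergence. *)
have /choice[F hF] (n : nat) : exists liv : R * nat * X,
    let: (l, i, v) := liv in let z := iter i (resolvent A l) x in
    [/\ 0 < l <= d, i%:R * l <= (chi R B n)%:R, A z v, `|v| <= `|y| &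
        `|duality_map (z - zero_proj A z) v| <= n.+1%:R^-1].
  have chi0 : (0 < chi R B n)%N.
    rewrite lt0n; apply/eqP => c0; have := chi_gt B n; rewrite c0 mulr0 mul0r.
    by rewrite ltNge sqr_ge0.
  have [l [i [v hliv]]] := exists_slow_iterate Pom Axy xB chi0 d0 (chi_gt B n).
  by exists (l, i, v).
pose z n := iter (F n).1.2 (resolvent A (F n).1.1) x.
have cx : closure (op_dom A) x by apply: subset_closure; exists y.
have [||n|n nO zn] := Om z (fun n => (F n).2) K id _ _ _ (3 * k + 2)%N.
- by move=> n; have := hF n; rewrite /z; case: (F n) => [[l i] v] [].
- move=> n; have := hF n; rewrite /z; case: (F n) => [[l i] v] /=.
  move=> [/andP[l0 _] _ _ vy _]; split; last exact: le_trans yK.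
  apply: le_trans BK.
  have := iter_resolvent_fejer X_smooth A_maccretive x (ltW l0) p_zero (leq0n i).
  move=> /= hz; have := ler_normD (iter i (resolvent A l) x - p) p.
  rewrite subrK natrD in xB *; lra.
- move=> m nm; have := hF m; rewrite /z; case: (F m) => [[l i] v] /= [_ _ _ _ hp].
  by apply: (le_trans hp); rewrite lef_pV2 ?posrE// ler_nat.
exists (zero_proj A (z n)); first exact: P_zero.
move=> t tO tT.
have t0 : 0 <= t by apply: le_trans tO.
move: zn; have := hF n; rewrite /z; case: (F n) => [[l i] v] /=.
move=> [/andP[l0 ld] il _ _ _]; set w := iter i _ x => hw.
have := hd l t l0 ld t0 tT.
(* The good iterate occurs by time [chi n], hence no later than the start of the window. *)
have ij : (i <= Num.truncn (t / l))%N.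
  rewrite truncn_ge_nat; last by rewrite divr_ge0// ltW.
  rewrite ler_pdivlMr// (le_trans il)// (le_trans _ tO)// ler_nat.
  exact: chi_mono.
have := iter_resolvent_fejer X_smooth A_maccretive x (ltW l0) (P_zero w) ij.
rewrite -/w -/P in hw *; set w' := iter _ _ x => hf hg.
have h3 := semigroup_nonexp X_smooth A_maccretive t0 ca cx.
have := ler_distD (semigroup A t x) (semigroup A t a) (P w).
have := ler_distD w' (semigroup A t x) (P w).
rewrite -hE in hw; rewrite distrC in xa; lra.
Qed.

End Convergence.

(** * Transfer to the almost-orbit *)

Unset Implicit Arguments.

Theorem theorem4p6 (R : realType) (X : completeNormedModType R)
  (X_convex : uniformly_convex X) (X_smooth : uniformly_smooth X)
  (A : X -> set X) (A_maccretive : m_accretive A)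
  (Omega : nat -> (nat -> nat) -> nat -> nat)
  (Omega_modulus : weak_modulus A Omega)
  (p : X) (p_zero : zeros A p)
  (omega : nat -> nat -> nat)
  (omega_modulus : unif_cont_modulus (zero_proj A) p omega)
  (omega_ge : forall r k : nat, (k <= omega r k)%N)
  (u : R -> X) (u_orbit : almost_orbit A u)
  (Phi : nat -> (nat -> nat) -> nat)
  (Phi_rate : metastability_rate A u Phi)
  (B : nat) (B_gt0 : (0 < B)%N)
  (u_bound : forall t : R, 0 <= t -> `|u t - p| <= B%:R)
  (f_ : R -> nat -> nat)
  (f_nondecreasing : forall s : R, 0 <= s ->
     {homo f_ s : m n / (m <= n)%N})
  (f_approx : forall s : R, 0 <= s -> forall n : nat, exists x y : X,
     [/\ A x y, `|x| <= (f_ s n)%:R, `|y| <= (f_ s n)%:R &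
         `|x - u s| <= n.+1%:R^-1])
  (K : R -> nat -> nat)
  (K_ge : forall s : R, 0 <= s -> forall k : nat,
     Num.max (f_ s (omega (B + 1)%N (3 * k + 2)%N))%:R (B%:R + 1 + `|p|)
       <= (K s k)%:R) :
  forall (k : nat) (f : nat -> nat),
    exists2 n : nat, (n <= Gamma B Omega K omega Phi k f)%N &
      forall t t' : R,
        n%:R <= t <= n%:R + (f n)%:R -> n%:R <= t' <= n%:R + (f n)%:R ->
        `|u t - u t'| <= k.+1%:R^-1.
Proof.
move=> k f.
have cu t : 0 <= t -> closure (op_dom A) (u t) by case: u_orbit => _ + _; exact.
have invS (m n : nat) : (m <= n)%N -> n.+1%:R^-1 <= m.+1%:R^-1 :> R.
  by move=> mn; rewrite lef_pV2 ?posrE// ler_nat.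
set k1 := (8 * k + 7)%N.
have [h hE] : exists h : R, h = k1.+1%:R^-1 by eexists.
have -> : k.+1%:R^-1 = 8 * h.
  by rewrite hE /k1 -addnS [(8 * k)%N]mulnC addnC -mulSn natrM invfM mulrCA
    divff ?mulr1// pnatr_eq0.
have h0 : 0 < h by rewrite hE invr_gt0.
pose G := Gamma' B Omega K omega Phi k1 (j_fun Phi k f).
(* First use of metastability: [u] stays near one zero [q] on a window whose length [j_fun]
   anticipates the second use. *)
have [n nG [q [Aq hq]]] : exists2 n : nat, (n <= G)%N & exists q, zeros A q /\
    forall t, n%:R <= t <= n%:R + (j_fun Phi k f n)%:R -> `|u t - q| <= h.
  set k2 := (3 * k1 + 2)%N.
  have h3 : k2.+1%:R^-1 = h / 3.
    by rewrite hE /k2 -addnS [(3 * k1)%N]mulnC addnC -mulSn natrM invfM.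
  (* Measured from [m], [g_fun] covers the delay [O] and then the whole window starting at
     [m + O]. *)
  have [m mM hm] := Phi_rate (omega B k2) (g_fun B Omega K k1 (j_fun Phi k f)).
  have m0 : 0 <= m%:R :> R by [].
  pose O := Omega_at B Omega K (m%:R : R) k2.
  exists (m + O)%N.
    rewrite /G /Gamma' leq_add//.
    exact: (leq_bigmax (F := fun i : 'I__ => Omega_at B Omega K (i%:R : R) k2)
      (Ordinal (mM : (m < _.+1)%N))).
  have [x [y [Axy _ yf xu]]] := f_approx _ m0 (omega (B + 1)%N (3 * k2 + 2)%N).
  have := K_ge _ m0 k2; rewrite ge_max => /andP[fK BK].
  have [q Aq hq] := semigroup_near_zero X_convex X_smooth A_maccretive p_zero
    Omega_modulus omega_modulus (cu _ m0) (u_bound _ m0) Axy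
    (le_trans xu (invS _ _ (omega_ge _ _))) (le_trans yf fK) BK
    (ler0n R (g_fun B Omega K k1 (j_fun Phi k f) m)).
  exists q; split => // t; rewrite natrD => /andP[t1 t2].
  have tm0 : 0 <= t - m%:R by have := ler0n R O; lra.
  have tO : O%:R <= t - m%:R by lra.
  have tg : t - m%:R <= (g_fun B Omega K k1 (j_fun Phi k f) m)%:R.
    by rewrite /g_fun -/O natrD; lra.
  have := hq _ tO tg; rewrite h3 => hS.
  have := hm (t - m%:R); rewrite tm0 tg subrK => /(_ isT) hu.
  have := le_trans hu (invS _ _ (omega_ge _ _)); rewrite h3 => {}hu.
  have := ler_distD (semigroup A (t - m%:R) (u m%:R)) (u t) q.
  rewrite distrC in hu; lra.
(* Second use: the point [n'] may fall before or after [n], hence the maximum [N]. *)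
have [n' nPhi hn'] := Phi_rate k1 (h_fun n f).
have n'0 : 0 <= n'%:R :> R by [].
pose N := maxn n n'.
have nN : n%:R <= N%:R :> R by rewrite ler_nat leq_maxl.
have n'N : n'%:R <= N%:R :> R by rewrite ler_nat leq_maxr.
(* The truncated subtraction in [h_fun] is exact since [n' <= N]; the window from [n'] ends at
   [N + f N]. *)
have hfun : (h_fun n f n')%:R = (f N)%:R + N%:R - n'%:R :> R.
  by rewrite /h_fun -/N natrB ?natrD// (leq_trans (leq_maxr n n'))// leq_addl.
have hS t : N%:R <= t -> t <= N%:R + (f N)%:R ->
    `|semigroup A (t - n'%:R) (u n'%:R) - u t| <= h.
  move=> t1 t2; have := hn' (t - n'%:R); rewrite subrK hE; apply.
  rewrite hfun; apply/andP; split; lra.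
exists N.
  rewrite /Gamma -/k1 -/G geq_max !leq_max nG/=; apply/orP; right.
  apply: (leq_trans nPhi).
  exact: (leq_bigmax (F := fun i : 'I__ => Phi k1 (h_fun i f))
    (Ordinal (nG : (n < _.+1)%N))).
have fN0 := ler0n R (f N).
(* The window of length [j_fun] reaches [N], because [n'] is bounded by the value of [Phi] built
   into it. *)
have uN : `|u N%:R - q| <= h.
  apply: hq; rewrite nN/= -natrD ler_nat /j_fun subnKC ?leq_maxl//.
  by rewrite geq_max leq_maxl/= (leq_trans nPhi)// leq_maxr.
have SN : `|semigroup A (N%:R - n'%:R) (u n'%:R) - q| <= 2 * h.
  have := hS N%:R (lexx _); rewrite lerDl => /(_ fN0) hN.
  have := ler_distD (u N%:R) (semigroup A (N%:R - n'%:R) (u n'%:R)) q; lra.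
(* From time [N] on, the Fejer property keeps the semigroup orbit of [u n'] within [2 * h] of [q];
   returning to [u] costs one more [h]. *)
have uq t : N%:R <= t <= N%:R + (f N)%:R -> `|u t - q| <= 3 * h.
  move=> /andP[t1 t2].
  have Nn : 0 <= N%:R - n'%:R :> R by rewrite subr_ge0.
  have Nt : N%:R - n'%:R <= t - n'%:R by rewrite lerD2r.
  have := semigroup_fejer X_smooth A_maccretive (cu _ n'0) Aq Nn Nt.
  have := hS t t1 t2; rewrite distrC.
  have := ler_distD (semigroup A (t - n'%:R) (u n'%:R)) (u t) q; lra.
(* Two such distances add up to [6 * h], within the allowed [8 * h]. *)
move=> t t' /uq ht /uq ht'.
have := ler_distD q (u t) (u t'); rewrite [`|q - u t'|]distrC; lra.
Qed.
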